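(* Within the pseudovariety $\mathsf M$ of all finite monoids, each of the sets of pseudoidentities $\Sigma=\{x^{\omega+1}=x^\omega,\ (xy)^\omega=(yx)^\omega\}$ and $\Gamma=\{(xy)^\omega x=(xy)^\omega,\ (xy)^\omega=y(xy)^\omega\}$ is h-strong.
   Context: $\mathsf M$ is the pseudovariety of finite monoids (signature: multiplication and $1$); $\Omega_A\mathsf M$ is the free profinite monoid on a finite set $A$. In a profinite monoid $x^\omega=\lim x^{n!}$ and $x^{\omega+1}=x^\omega x$. An $\mathsf M$-pseudoidentity is $u=v$ with $u,v\in\Omega_B\mathsf M$, $B$ finite; it holds in a finite monoid $T$ if both sides agree under every continuous homomorphism $\Omega_B\mathsf M\to T$; $[\![\Sigma]\!]$ is the class of finite monoids satisfying $\Sigma$. Provability: for finite $A$, $\Sigma_0\subseteq\Omega_A\mathsf M\times\Omega_A\mathsf M$ is the set of pairs $(\mathbf t(\varphi(u),w_1,\dots,w_n),\mathbf t(\varphi(v),w_1,\dots,w_n))$ with $u=v$ or $v=u$ in $\Sigma$ ($u,v\in\Omega_B\mathsf M$), $\varphi:\Omega_B\mathsf M\to\Omega_A\mathsf M$ a continuous homomorphism, $\mathbf t$ a monoid term, $w_i\in\Omega_A\mathsf M$; $\Sigma_{2\alpha+1}$ is the transitive closure of $\Sigma_{2\alpha}$, $\Sigma_{2\alpha+2}$ the topological closure of $\Sigma_{2\alpha+1}$, unions at limit ordinals; $u=v$ is provable from $\Sigma$ if $(u,v)\in\bigcup_\alpha\Sigma_\alpha$. A set $\Sigma$ is h-strong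 within $\mathsf M$ if every $\mathsf M$-pseudoidentity valid in $[\![\Sigma]\!]$ is provable from $\Sigma$. *)

(* Defs.v *)
(* Free profinite monoids are represented as
   monoids of implicit operations. *)
From Stdlib Require Import FunctionalExtensionality.
From mathcomp Require Import all_boot.
Set Implicit Arguments. Unset Strict Implicit. Unset Printing Implicit Defensive.

Record finMonoid := FinMonoid {
  fm_sort :> finType;
  fm_mul : fm_sort -> fm_sort -> fm_sort;
  fm_one : fm_sort;
  fm_mulA : associative fm_mul;
  fm_mul1l : left_id fm_one fm_mul;
  fm_mul1r : right_id fm_one fm_mul }.

Arguments fm_mul {_}. Arguments fm_one {_}.

Record fmHom (M N : finMonoid) := FmHom {
  hom_fun :> M -> N;
  hom_one : hom_fun fm_one = fm_one;
  hom_mul : forall x y, hom_fun (fm_mul x y) = fm_mul (hom_fun x) (hom_fun y) }.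

Definition fpow (M : finMonoid) (a : M) (n : nat) : M := iter n (fm_mul a) fm_one.

(* omega power in a finite monoid M: a^(|M|!), the (eventually constant)
   value of the sequence a^(n!) *)
Definition fomega (M : finMonoid) (a : M) : M := fpow a (#|fm_sort M|)`!.

Section PowLemmas.
Variable M : finMonoid.
Implicit Types a b : M.

Lemma fpowD a m n : fpow a (m + n) = fm_mul (fpow a m) (fpow a n).
Proof.
elim: m => [|m IH]; first by rewrite add0n /= fm_mul1l.
rewrite addSn; change (fm_mul a (fpow a (m + n)) = fm_mul (fm_mul a (fpow a m)) (fpow a n)).
by rewrite IH fm_mulA.
Qed.

Lemma fpowM a m n : fpow a (m * n) = fpow (fpow a m) n.
Proof.
elim: n => [|n IH]; first by rewrite muln0.
by rewrite mulnS fpowD IH.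
Qed.

Lemma fpow_idem (e : M) k : fm_mul e e = e -> 0 < k -> fpow e k = e.
Proof.
move=> He; elim: k => [//|[|k] IH _]; first by rewrite /fpow /= fm_mul1r.
by change (fm_mul e (fpow e k.+1) = e); rewrite IH.
Qed.

Lemma idem_pow_unique a i j : 0 < i -> 0 < j ->
  fm_mul (fpow a i) (fpow a i) = fpow a i ->
  fm_mul (fpow a j) (fpow a j) = fpow a j -> fpow a i = fpow a j.
Proof.
move=> i0 j0 Hi Hj.
by rewrite -(fpow_idem Hi j0) -fpowM mulnC fpowM (fpow_idem Hj i0).
Qed.

Lemma fomega_idem a : fm_mul (fomega a) (fomega a) = fomega a.
Proof.
pose n := #|fm_sort M|.
have n0 : 0 < n by apply/card_gt0P; exists fm_one.
pose g := fun k : 'I_n.+1 => fpow a k.+1.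
have : ~~ injectiveb g.
  apply/negP => /injectiveP Hg; have := @leq_card _ _ g Hg.
  rewrite card_ord. by rewrite ltnn.
case/injectivePn => i [j] nij; rewrite /g => Eij.
wlog lt_ij : i j nij Eij / i < j.
  move=> W; case: (ltngtP i j) => h; first exact: (W i j).
  - by apply: (W j i) => //; rewrite eq_sym.
  - by move: nij; rewrite (val_inj h) eqxx.
have jn0 : j <= n by rewrite -ltnS ltn_ord.
have ltin : i < n by apply: leq_trans lt_ij jn0.
have jn : j <= n by rewrite -ltnS ltn_ord.
move: Eij; move: (val i) (val j) lt_ij ltin jn => {nij g} i' j' lt_ij ltin jn Eij.
pose s := i'.+1; pose p := j' - i'.
have p0 : 0 < p by rewrite subn_gt0.
have Esp : fpow a (s + p) = fpow a s.
  rewrite /s /p addSn subnKC; [exact: esym Eij | exact: ltnW].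
have Ek : forall k m, s <= k -> fpow a (k + m * p) = fpow a k.
  move=> k m sk; elim: m => [|m IH]; first by rewrite addn0.
  rewrite mulSn (addnC p) addnA fpowD IH.
  rewrite -fpowD -(subnKC sk) (addnC s) -addnA fpowD Esp -fpowD; reflexivity.
have sN : s <= n`! := leq_trans ltin (fact_geq n).
have pN : p %| n`!.
  apply: dvdn_fact; rewrite p0 /=; apply: leq_trans (leq_subr _ _) jn.
rewrite /fomega -/n -fpowD -{2}(divnK pN).
exact: Ek.
Qed.

End PowLemmas.

Lemma fomega_hom (M N : finMonoid) (h : fmHom M N) (a : M) : h (fomega a) = fomega (h a).
Proof.
have hp : forall k, h (fpow a k) = fpow (h a) k.
  elim=> [|k IH]; first exact: hom_one.
  by change (h (fm_mul a (fpow a k)) = fm_mul (h a) (fpow (h a) k)); rewrite hom_mul IH.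
rewrite /fomega hp; apply: idem_pow_unique; rewrite ?fact_gt0 //.
  rewrite -hp -hom_mul; exact: (congr1 h (fomega_idem a)).
exact: fomega_idem.
Qed.

(* Omega_A M is represented as the monoid of A-ary implicit operations on
   finite monoids: families (pi_T : (A -> T) -> T)_T indexed by all finite
   monoids T, natural w.r.t. all monoid homomorphisms between finite monoids.
   The continuous homomorphisms Omega_A M -> T (T finite) are exactly the
   evaluations  u |-> omg_op u T f  for f : A -> T. *)
Definition natural (A : finType) (op : forall T : finMonoid, (A -> T) -> T) :=
  forall (T T' : finMonoid) (h : fmHom T T') (f : A -> T),
    h (op T f) = op T' (fun a => h (f a)).

Record Omega (A : finType) := MkOmega {
  omg_op : forall T : finMonoid, (A -> T) -> T;
  omg_nat : natural omg_op }.
Arguments omg_op {A} o T f.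
Arguments omg_nat {A} o T T' h f.

Section OmegaOps.
Variable A : finType.

Definition oletter (a : A) : Omega A :=
  @MkOmega A (fun T f => f a) (fun T T' h f => erefl).

Definition oone : Omega A.
Proof.
refine (@MkOmega A (fun T f => fm_one) _).
by move=> T T' h f; exact: hom_one.
Defined.

Definition omul (u v : Omega A) : Omega A.
Proof.
refine (@MkOmega A (fun T f => fm_mul (omg_op u T f) (omg_op v T f)) _).
by move=> T T' h f; rewrite hom_mul !omg_nat.
Defined.

Definition oomega (u : Omega A) : Omega A.
Proof.
refine (@MkOmega A (fun T f => fomega (omg_op u T f)) _).
by move=> T T' h f; rewrite fomega_hom omg_nat.
Defined.
End OmegaOps.

(* continuous homomorphism Omega_B M -> Omega_A M determined by the images
   phi : B -> Omega_A M of the free generators *)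
Definition osubst (A B : finType) (phi : B -> Omega A) (u : Omega B) : Omega A.
Proof.
refine (@MkOmega A (fun T f => omg_op u T (fun b => omg_op (phi b) T f)) _).
move=> T T' h f; rewrite omg_nat; congr (omg_op u T' _).
by apply: functional_extensionality => b; rewrite omg_nat.
Defined.

Record pseudoid := PseudoId {
  pid_alph : finType;
  pid_lhs : Omega pid_alph;
  pid_rhs : Omega pid_alph }.

Definition pseudoset := pseudoid -> Prop.

Definition holds_in (T : finMonoid) (p : pseudoid) : Prop :=
  forall f : pid_alph p -> T, omg_op (pid_lhs p) T f = omg_op (pid_rhs p) T f.

Definition models (T : finMonoid) (S : pseudoset) : Prop :=
  forall p, S p -> holds_in T p.

Inductive mterm := TVar of nat | TOne | TMul of mterm & mterm.

Fixpoint teval (A : finType) (env : nat -> Omega A) (t : mterm) : Omega A :=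
  match t with
  | TVar i => env i
  | TOne => oone A
  | TMul t1 t2 => omul (teval env t1) (teval env t2)
  end.

Definition tenv (A : finType) (z : Omega A) (w : nat -> Omega A) : nat -> Omega A :=
  fun i => if i is k.+1 then w k else z.

Definition Sigma0 (S : pseudoset) (A : finType) (x y : Omega A) : Prop :=
  exists p, S p /\ exists (phi : pid_alph p -> Omega A) (t : mterm)
                          (w : nat -> Omega A),
    let l := teval (tenv (osubst phi (pid_lhs p)) w) t in
    let r := teval (tenv (osubst phi (pid_rhs p)) w) t in
    (x = l /\ y = r) \/ (x = r /\ y = l).

(* (x, y) lies in the topological closure of R in Omega_A M x Omega_A M:
   every basic neighbourhood of (x, y) (given by a continuous homomorphism
   onto a finite monoid, i.e. an evaluation f : A -> T) meets R *)
Definition in_closure (A : finType) (R : Omega A -> Omega A -> Prop)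
  (x y : Omega A) : Prop :=
  forall (T : finMonoid) (f : A -> T), exists x' y', R x' y' /\
    omg_op x' T f = omg_op x T f /\ omg_op y' T f = omg_op y T f.

(* the union of the transfinite sequence Sigma_alpha: the least relation
   containing Sigma_0 that is transitive and topologically closed *)
Inductive provable (S : pseudoset) (A : finType) : Omega A -> Omega A -> Prop :=
  | prov_base x y : Sigma0 S x y -> provable S x y
  | prov_trans x y z : provable S x y -> provable S y z -> provable S x z
  | prov_closure x y : in_closure (provable S (A:=A)) x y -> provable S x y.

Definition h_strong (S : pseudoset) : Prop :=
  forall (B : finType) (u v : Omega B),
    (forall T : finMonoid, models T S -> holds_in T (PseudoId u v)) ->
    provable S u v.

Definition vx : Omega 'I_2 := oletter (@Ordinal 2 0 isT).
Definition vy : Omega 'I_2 := oletter (@Ordinal 2 1 isT).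

Definition SigmaSet : pseudoset := fun p =>
  p = PseudoId (omul (oomega vx) vx) (oomega vx) \/
  p = PseudoId (oomega (omul vx vy)) (oomega (omul vy vx)).

Definition GammaSet : pseudoset := fun p =>
  p = PseudoId (omul (oomega (omul vx vy)) vx) (oomega (omul vx vy)) \/
  p = PseudoId (oomega (omul vx vy)) (omul vy (oomega (omul vx vy))).

(* Main.v *)
(* Both sets imply, provably, that (pq)^w p = (pq)^w = q (pq)^w, so w^w absorbs on both sides
   every word whose letters occur in w, and up to provability w^w depends only on the content
   of w.  Hence finite products of letters and of such idempotents serve as normal forms.

   Every u is provably equal to a normal form: among the patterns s = s_1 ... s_k, each s_i a
   letter or a set C of letters (standing for C^* ), such that every finite monoid sees u as the
   value of a word matching s, take one that cannot be refined.  Being unrefinable forces the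
   factor matched by C to contain as many consecutive blocks of full content as desired, and the
   pigeonhole principle in a finite monoid then turns that factor into some p q^w r.

   If u and v agree on all finite monoids satisfying the identities, then they agree on the
   monoids of monotone inflationary maps of finite chains, which detect subwords.  Expanding the
   idempotents into high powers, each normal form therefore embeds into the other, and two
   mutually embeddable normal forms are provably equal by absorption. *)
Require Import Defs.
From Stdlib Require Import FunctionalExtensionality Setoid Morphisms.
From mathcomp Require Import all_boot.
From mathcomp Require Import boolp.
Set Implicit Arguments. Unset Strict Implicit. Unset Printing Implicit Defensive.

(** * Monoid structure of the implicit operations *)

Lemma omega_ext (A : finType) (u v : Omega A) :
  (forall T f, omg_op u T f = omg_op v T f) -> u = v.
Proof.
case: u v => [u nu] [v nv] /= uv.
have E : u = v.
  apply: functional_extensionality_dep => T.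
  by apply: functional_extensionality => f.
by subst v; congr MkOmega; exact: Prop_irrelevance.
Qed.

Section OmegaMonoid.
Variable A : finType.
Implicit Types p q u : Omega A.

Lemma omulA p q u : omul p (omul q u) = omul (omul p q) u.
Proof. by apply: omega_ext => T f; exact: fm_mulA. Qed.

Lemma omul1l p : omul (oone A) p = p.
Proof. by apply: omega_ext => T f; exact: fm_mul1l. Qed.

Lemma omul1r p : omul p (oone A) = p.
Proof. by apply: omega_ext => T f; exact: fm_mul1r. Qed.

Definition opow p n : Omega A := iter n (omul p) (oone A).

Lemma opow_op p n T f : omg_op (opow p n) T f = fpow (omg_op p T f) n.
Proof. by elim: n => //= n ->. Qed.

Lemma opowS p n : opow p n.+1 = omul p (opow p n).
Proof. by []. Qed.

Lemma opowSr p n : opow p n.+1 = omul (opow p n) p.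
Proof.
apply: omega_ext => T f; rewrite opow_op -addn1 fpowD /= opow_op.
by congr fm_mul; rewrite /fpow /= fm_mul1r.
Qed.

(** The analogue for finite exponents is an induction, and in [T] the ω-power is the power of
    exponent [#|T|!]. It is thus an equality of implicit operations, not only a provable one. *)
Lemma oomega_rotate p q : omul (oomega (omul p q)) p = omul p (oomega (omul q p)).
Proof.
have E n : omul (opow (omul p q) n) p = omul p (opow (omul q p) n).
  by elim: n => [|n IH]; rewrite /= ?omul1l ?omul1r // -omulA IH !omulA.
apply: omega_ext => T f; have := congr1 (fun x => omg_op x T f) (E (#|T|)`!).
by rewrite /= !opow_op.
Qed.

Lemma oomega_commute p : omul (oomega p) p = omul p (oomega p).
Proof. by have := oomega_rotate p (oone A); rewrite omul1l omul1r. Qed.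

End OmegaMonoid.

(** * Provability: induction, soundness, congruence *)

(* The automatic induction principle gives no hypothesis for the relation nested inside [in_closure]. *)
Lemma provable_nind S A (P : Omega A -> Omega A -> Prop) :
  (forall x y, Sigma0 S x y -> P x y) ->
  (forall x y z, P x y -> P y z -> P x z) ->
  (forall x y, in_closure P x y -> P x y) ->
  forall x y, provable S x y -> P x y.
Proof.
move=> H0 Htr Hcl; fix IH 3 => x y; case.
- exact: H0.
- by move=> x' y' z' /IH xy /IH; exact: Htr.
- move=> x' y' Hc; apply: Hcl => T f; case: (Hc T f) => a [b [/IH ab E]].
  by exists a, b.
Qed.

(** Agreement at [f] is transitive, and it is closed because the neighbourhood defined by [f] itself
    fixes both values. *)
Lemma provable_sound S A (u v : Omega A) T : provable S u v -> models T S ->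
  forall f, omg_op u T f = omg_op v T f.
Proof.
move=> uv mT f; move: u v uv; apply: provable_nind => [x y|x y z -> //|x y].
- case=> p [Sp [phi [t [w xy]]]].
  have E : omg_op (osubst phi (pid_lhs p)) T f = omg_op (osubst phi (pid_rhs p)) T f.
    exact: mT.
  suff Et : omg_op (teval (tenv (osubst phi (pid_lhs p)) w) t) T f =
            omg_op (teval (tenv (osubst phi (pid_rhs p)) w) t) T f.
    by case: xy => -[-> ->].
  by elim: t {xy} => [[|n]||t1 E1 t2 E2] //=; rewrite -/(teval _ _) E1 E2.
- by case/(_ T f) => x' [y' [E [<- <-]]].
Qed.

Section Congruence.
Variables (S : pseudoset) (A : finType).
Hypothesis S_inh : exists p, S p.
Implicit Types p q u v x y z : Omega A.
Local Notation "x ~~~ y" := (provable S x y) (at level 70).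

(** Take a term that avoids the hole [TVar 0]; some member of [S] is still required to instantiate
    [Sigma0]. *)
Lemma provable_refl x : x ~~~ x.
Proof.
have [p Sp] := S_inh; apply: prov_base; exists p; split => //.
by exists (fun _ => oone A), (TVar 1), (fun _ => x); left.
Qed.

Lemma provable_sym x y : x ~~~ y -> y ~~~ x.
Proof.
move: x y; apply: provable_nind => [x y|x y z xy yz|x y xy].
- case=> p [Sp [phi [t [w xy]]]]; apply: prov_base; exists p; split => //.
  by exists phi, t, w; case: xy => -[-> ->]; [right | left].
- exact: prov_trans yz xy.
- by apply: prov_closure => T f; have [a [b [ab [E1 E2]]]] := xy T f; exists b, a.
Qed.

(** Variable 0 stays the hole for the substituted identity, while the parameters move up by one and
    free [TVar 1] for an outer multiplier. *)
Fixpoint tshift (t : mterm) : mterm :=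
  match t with
  | TVar 0 => TVar 0
  | TVar n.+1 => TVar n.+2
  | TOne => TOne
  | TMul t1 t2 => TMul (tshift t1) (tshift t2)
  end.

Lemma tshiftE t p z (w : nat -> Omega A) :
  teval (tenv z (fun i => if i is k.+1 then w k else p)) (tshift t) =
  teval (tenv z w) t.
Proof. by elim: t => [[|n]||t1 E1 t2 E2] //=; rewrite E1 E2. Qed.

Lemma provable_mull p x y : x ~~~ y -> omul p x ~~~ omul p y.
Proof.
move: x y; apply: provable_nind => [x y|x y z xy yz|x y xy].
- case=> i [Si [phi [t [w xy]]]]; apply: prov_base; exists i; split => //.
  exists phi, (TMul (TVar 1) (tshift t)), (fun i => if i is k.+1 then w k else p).
  by rewrite /= !tshiftE; case: xy => -[-> ->]; [left | right].
- exact: prov_trans xy yz.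
- apply: prov_closure => T f; have [a [b [ab [E1 E2]]]] := xy T f.
  by exists (omul p a), (omul p b); rewrite /= E1 E2.
Qed.

Lemma provable_mulr p x y : x ~~~ y -> omul x p ~~~ omul y p.
Proof.
move: x y; apply: provable_nind => [x y|x y z xy yz|x y xy].
- case=> i [Si [phi [t [w xy]]]]; apply: prov_base; exists i; split => //.
  exists phi, (TMul (tshift t) (TVar 1)), (fun i => if i is k.+1 then w k else p).
  by rewrite /= !tshiftE; case: xy => -[-> ->]; [left | right].
- exact: prov_trans xy yz.
- apply: prov_closure => T f; have [a [b [ab [E1 E2]]]] := xy T f.
  by exists (omul a p), (omul b p); rewrite /= E1 E2.
Qed.

#[local] Instance provable_equivalence : Equivalence (@provable S A).
Proof.
split; [exact: provable_refl | exact: provable_sym | exact: prov_trans].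
Qed.

#[local] Instance omul_proper : Proper (@provable S A ==> @provable S A ==> @provable S A) (@omul A).
Proof.
by move=> x x' xx' y y' yy'; apply: prov_trans (provable_mull _ yy'); exact: provable_mulr.
Qed.

Lemma provable_inst (l r : Omega 'I_2) p q : S (PseudoId l r) ->
  osubst (fun i => if val i == 0 then p else q) l ~~~
  osubst (fun i => if val i == 0 then p else q) r.
Proof.
move=> Sp; apply: prov_base; exists (PseudoId l r); split=> //.
by exists (fun i => if val i == 0 then p else q), (TVar 0), (fun _ => oone A); left.
Qed.

Lemma provable_eqop x y x' y' : x ~~~ y ->
  (forall T f, omg_op x T f = omg_op x' T f) ->
  (forall T f, omg_op y T f = omg_op y' T f) -> x' ~~~ y'.
Proof. by move=> xy /omega_ext <- /omega_ext <-. Qed.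

(** * Absorption laws derived from each of the two sets *)

Hypothesis aper : forall p, omul (oomega p) p ~~~ oomega p.
Hypothesis comm : forall p q, oomega (omul p q) ~~~ oomega (omul q p).

(* Modulo provability, e = (pq)^w commutes with p and q, so ep and eq are mutually inverse
   in e Omega e, and aperiodicity makes them equal to e. *)
Lemma Sigma_absorbl p q : omul p (oomega (omul p q)) ~~~ oomega (omul p q).
Proof.
set e := oomega _; set f := oomega (omul q p).
have ef : e ~~~ f by exact: comm.
have ep : omul e p ~~~ omul p e by rewrite oomega_rotate -/f ef; reflexivity.
have eq : omul e q ~~~ omul q e.
  by transitivity (omul f q); [rewrite ef | rewrite oomega_rotate]; reflexivity.
have epq : omul (omul e p) q ~~~ e by rewrite -omulA; exact: aper.
(* Write p^(n+1) q^(n+1) as p (p^n q^n) q and slide e past the outer p, so that the induction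
   hypothesis applies in the middle. *)
have epn n : omul (omul e (opow p n)) (opow q n) ~~~ e.
  elim: n => [|n IH]; first by rewrite !omul1r; reflexivity.
  rewrite (opowSr q) (opowS p) !omulA ep.
  rewrite -!(omulA p) IH omulA -ep; exact: epq.
have epw : omul (omul e (oomega p)) (oomega q) ~~~ e.
  apply: prov_closure => T h.
  exists (omul (omul e (opow p (#|T|)`!)) (opow q (#|T|)`!)), e; split => //.
  by rewrite /= !opow_op.
(* Replace e by e p^ω q^ω; then p^ω swallows the extra p. *)
rewrite -{1}epw !omulA -ep -(omulA e) -oomega_commute.
by rewrite -(omulA e) omulA (aper p) -omulA omulA; exact: epw.
Qed.

Lemma Sigma_absorb p q : omul (oomega (omul p q)) p ~~~ oomega (omul p q) /\
  omul q (oomega (omul p q)) ~~~ oomega (omul p q).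
Proof.
split; last by rewrite comm; exact: Sigma_absorbl.
by rewrite oomega_rotate comm; exact: Sigma_absorbl.
Qed.

End Congruence.

(** The common consequence of both sets: with inhabitedness of [S], it is all that the reduction to
    normal forms and their comparison rely on. *)
Definition absorbing (S : pseudoset) := forall (A : finType) (p q : Omega A),
  provable S (omul (oomega (omul p q)) p) (oomega (omul p q)) /\
  provable S (omul q (oomega (omul p q))) (oomega (omul p q)).

Lemma Sigma_absorbing : absorbing SigmaSet.
Proof.
have inh : exists p, SigmaSet p by eexists; left.
move=> A p q; apply: Sigma_absorb => // [x|x y].
  by apply: (provable_eqop (provable_inst x x (or_introl erefl))).
by apply: (provable_eqop (provable_inst x y (or_intror erefl))).
Qed.

Lemma Gamma_absorbing : absorbing GammaSet.
Proof.
have inh : exists p, GammaSet p by eexists; left.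
move=> A p q; split.
  by apply: (provable_eqop (provable_inst p q (or_introl erefl))).
apply: provable_sym => //.
by apply: (provable_eqop (provable_inst p q (or_intror erefl))).
Qed.

(** * Words and their closure among implicit operations *)

Section Words.
Variable A : finType.
Implicit Types (w : seq A) (C : {set A}) (u : Omega A).

Definition wev (T : finMonoid) (f : A -> T) w : T :=
  foldr (fun a => fm_mul (f a)) fm_one w.

Lemma wev_cat (T : finMonoid) (f : A -> T) w1 w2 : wev f (w1 ++ w2) = fm_mul (wev f w1) (wev f w2).
Proof. by elim: w1 => [|a w1 IH] /=; rewrite ?fm_mul1l // IH fm_mulA. Qed.

Definition oword w : Omega A := foldr (fun a => omul (oletter a)) (oone A) w.

Lemma oword_op w (T : finMonoid) (f : A -> T) : omg_op (oword w) T f = wev f w.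
Proof. by elim: w => //= a w <-. Qed.

Lemma oword_cat w1 w2 : oword (w1 ++ w2) = omul (oword w1) (oword w2).
Proof. by elim: w1 => [|a w1 IH] /=; rewrite ?omul1l // IH omulA. Qed.

Definition wpow n w := flatten (nseq n w).

Lemma wev_wpow (T : finMonoid) (f : A -> T) n w : wev f (wpow n w) = fpow (wev f w) n.
Proof. by elim: n => //= n IH; rewrite /wpow /= wev_cat IH. Qed.

Lemma mem_wpow n w : {subset wpow n w <= w}.
Proof. by move=> a /flattenP [x /nseqP [-> _]]. Qed.

(** That is, [u] lies in the topological closure of the words satisfying [P]. *)
Definition dense (P : seq A -> Prop) u := forall (T : finMonoid) (f : A -> T),
  exists w, P w /\ wev f w = omg_op u T f.

Section GeneratedSubmonoid.
Variables (T : finMonoid) (f : A -> T).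

Definition gen_pred : pred T := fun t => `[< exists w, wev f w = t >].
Definition gen_type := {t : T | gen_pred t}.

Lemma gen_one_subproof : gen_pred fm_one.
Proof. by apply/asboolP; exists [::]. Qed.

Lemma gen_mul_subproof (x y : gen_type) : gen_pred (fm_mul (val x) (val y)).
Proof.
case: x y => [x /= /asboolP [wx <-]] [y /= /asboolP [wy <-]].
by apply/asboolP; exists (wx ++ wy); exact: wev_cat.
Qed.

Definition gen_mul (x y : gen_type) : gen_type :=
  Sub (fm_mul (val x) (val y)) (gen_mul_subproof x y).
Definition gen_one : gen_type := Sub fm_one gen_one_subproof.

Lemma gen_mulA : associative gen_mul.
Proof. by move=> x y z; apply: val_inj; exact: fm_mulA. Qed.
Lemma gen_mul1l : left_id gen_one gen_mul.
Proof. by move=> x; apply: val_inj; exact: fm_mul1l. Qed.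
Lemma gen_mul1r : right_id gen_one gen_mul.
Proof. by move=> x; apply: val_inj; exact: fm_mul1r. Qed.

Definition gen_monoid := @FinMonoid gen_type gen_mul gen_one gen_mulA gen_mul1l gen_mul1r.

Lemma gen_letter_subproof a : gen_pred (f a).
Proof. by apply/asboolP; exists [:: a]; exact: fm_mul1r. Qed.

Definition gen_letter a : gen_monoid := (Sub (f a) (gen_letter_subproof a) : gen_type).

Definition gen_incl : fmHom gen_monoid T :=
  @FmHom gen_monoid T (fun x => val x) erefl (fun x y => erefl).

End GeneratedSubmonoid.

(** Naturality along the inclusion of the submonoid generated by the image of [f] forces the value
    of [u] to be a product of letters. *)
Lemma dense_words u : dense (fun _ => True) u.
Proof.
move=> T f; have := omg_nat u (gen_monoid f) T (gen_incl f) (gen_letter f).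
rewrite /= => <-; case: (omg_op u _ _) => t /= /asboolP [w <-]; by exists w.
Qed.

Section ProductMonoid.
Variables T1 T2 : finMonoid.

Definition prod_mul (x y : T1 * T2) := (fm_mul x.1 y.1, fm_mul x.2 y.2).

Lemma prod_mulA : associative prod_mul.
Proof. by move=> x y z; rewrite /prod_mul /= !fm_mulA. Qed.
Lemma prod_mul1l : left_id (fm_one, fm_one) prod_mul.
Proof. by case=> x y; rewrite /prod_mul /= !fm_mul1l. Qed.
Lemma prod_mul1r : right_id (fm_one, fm_one) prod_mul.
Proof. by case=> x y; rewrite /prod_mul /= !fm_mul1r. Qed.

Definition prod_monoid := @FinMonoid (T1 * T2)%type _ _ prod_mulA prod_mul1l prod_mul1r.

Definition prod_fst : fmHom prod_monoid T1 :=
  @FmHom prod_monoid T1 (fun x => x.1) erefl (fun x y => erefl).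
Definition prod_snd : fmHom prod_monoid T2 :=
  @FmHom prod_monoid T2 (fun x => x.2) erefl (fun x y => erefl).

End ProductMonoid.

Definition unit_monoid : finMonoid.
Proof. by apply: (@FinMonoid unit (fun _ _ => tt) tt) => // -[]. Defined.

Lemma wev_hom (T T' : finMonoid) (h : fmHom T T') (f : A -> T) w :
  h (wev f w) = wev (fun a => h (f a)) w.
Proof. by elim: w => [|a w IH] /=; rewrite ?hom_one // hom_mul IH. Qed.

(** Two evaluations form a single one into the product monoid, so neighbourhoods can be
    intersected. *)
Lemma dense_pair P u (T1 : finMonoid) (f1 : A -> T1) (T2 : finMonoid) (f2 : A -> T2) : dense P u ->
  exists w, [/\ P w, wev f1 w = omg_op u T1 f1 & wev f2 w = omg_op u T2 f2].
Proof.
move=> dP; have [w [Pw Ew]] := dP (prod_monoid T1 T2) (fun a => (f1 a, f2 a)).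
exists w; split=> //.
  by have := congr1 (prod_fst T1 T2) Ew; rewrite wev_hom omg_nat.
by have := congr1 (prod_snd T1 T2) Ew; rewrite wev_hom omg_nat.
Qed.

Lemma not_dense P u : ~ dense P u ->
  exists (T : finMonoid) (f : A -> T), forall w, P w -> wev f w <> omg_op u T f.
Proof.
move=> nd; apply: contrapT => H; apply: nd => T f; apply: contrapT => H'.
by apply: H; exists T, f => w Pw E; apply: H'; exists w.
Qed.

(** If some neighbourhood of [u] contains no word in [P], intersecting it with any other one leaves
    only words in [Q]. *)
Lemma dense_or P Q u : dense (fun w => P w \/ Q w) u -> dense P u \/ dense Q u.
Proof.
move=> dPQ; have [|/not_dense [T [f H]]] := pselect (dense P u); first by left.
right=> T' f'; have [w [[Pw|Qw] E E']] := dense_pair f f' dPQ; last by exists w.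
by case: (H w Pw).
Qed.

Lemma dense_exists (I : eqType) (r : seq I) (P : I -> seq A -> Prop) u :
  dense (fun w => exists2 i, i \in r & P i w) u -> exists2 i, i \in r & dense (P i) u.
Proof.
elim: r => [|i r IH] d.
  by have [w [[]]] := d unit_monoid (fun _ => tt).
have [|di|/IH [j jr dj]] := @dense_or (P i) (fun w => exists2 i, i \in r & P i w) u.
- move=> T f; have [w [[j + Pj] E]] := d T f; rewrite inE => /orP [/eqP ji|jr].
    by exists w; split => //; left; rewrite -ji.
  by exists w; split => //; right; exists j.
- by exists i; rewrite ?mem_head.
- by exists j; rewrite // inE jr orbT.
Qed.
End Words.

(** * Normal forms and absorption of factors *)

Section NormalForms.
Variable A : finType.
Implicit Types (w : seq A) (C : {set A}) (u : Omega A).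

(* [inl a] stands for the letter a, [inr C] for w^w where w is any word of content C. *)
Definition factor : Type := (A + {set A})%type.

Definition fval (x : factor) : Omega A :=
  match x with inl a => oletter a | inr C => oomega (oword (enum C)) end.

Definition nfval (s : seq factor) : Omega A := foldr (fun x => omul (fval x)) (oone A) s.

Definition fle C (x : factor) : bool :=
  match x with inl a => a \in C | inr D => D \subset C end.

Variable S : pseudoset.
Hypotheses (S_inh : exists p, S p) (S_abs : absorbing S).
Local Notation "x ~~~ y" := (provable S x y) (at level 70).

#[local] Instance provable_equivalence_instance : Equivalence (@provable S A).
Proof. exact: provable_equivalence. Qed.

#[local] Instance omul_proper_instance : Proper (@provable S A ==> @provable S A ==> @provable S A) (@omul A).
Proof. exact: omul_proper. Qed.

(** Write [w] as p a q. Cutting (p a q)^ω before and after [a] shows that it absorbs q and a q from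
    the left, p and p a from the right; hence also [a] from either side. *)
Lemma letter_absorb a w : a \in w ->
  omul (oletter a) (oomega (oword w)) ~~~ oomega (oword w) /\
  omul (oomega (oword w)) (oletter a) ~~~ oomega (oword w).
Proof.
case/splitPr => w1 w2; rewrite oword_cat /=.
set p := oword w1; set q := oword w2; set l := oletter a; set W := oomega _.
have [pW lqW] := S_abs p (omul l q).
have [plW qW] := S_abs (omul p l) q.
rewrite -/W in pW lqW; rewrite -omulA -/W in plW qW.
split; first by rewrite -{1}qW omulA; exact: lqW.
by rewrite -{1}pW -omulA; exact: plW.
Qed.

Lemma word_absorb v w : {subset v <= w} ->
  omul (oword v) (oomega (oword w)) ~~~ oomega (oword w) /\
  omul (oomega (oword w)) (oword v) ~~~ oomega (oword w).
Proof.
elim: v => [|a v IH] vw /=; first by rewrite omul1l omul1r; split; reflexivity.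
have [al ar] := letter_absorb (vw a (mem_head a v)).
have [|vl vr] := IH; first by move=> b bv; apply: vw; rewrite inE bv orbT.
split; first by rewrite -omulA vl.
by rewrite omulA ar.
Qed.

(** Every finite power of [v] is absorbed, and topological closure passes to the ω-power. *)
Lemma omega_absorb v w : {subset v <= w} ->
  omul (oomega (oword v)) (oomega (oword w)) ~~~ oomega (oword w) /\
  omul (oomega (oword w)) (oomega (oword v)) ~~~ oomega (oword w).
Proof.
move=> vw; have E n : {subset wpow n v <= w} by move=> a /mem_wpow; exact: vw.
split; apply: prov_closure => T f; have [El Er] := word_absorb (E (#|T|)`!);
  [exists (omul (oword (wpow (#|T|)`! v)) (oomega (oword w))) |
   exists (omul (oomega (oword w)) (oword (wpow (#|T|)`! v)))];
  exists (oomega (oword w)); split=> //=; by rewrite !oword_op wev_wpow.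
Qed.

Lemma omega_content v w : v =i w -> oomega (oword v) ~~~ oomega (oword w).
Proof.
move=> vw.
have [|E _] := @omega_absorb v w; first by move=> a; rewrite vw.
have [|_ E'] := @omega_absorb w v; first by move=> a; rewrite vw.
by rewrite -E -{1}E'; reflexivity.
Qed.

Lemma factor_absorb C x : fle C x ->
  omul (fval x) (fval (inr C)) ~~~ fval (inr C) /\
  omul (fval (inr C)) (fval x) ~~~ fval (inr C).
Proof.
case: x => [a|D] /= xC; first by apply: letter_absorb; rewrite mem_enum.
by apply: omega_absorb => a; rewrite !mem_enum; apply/subsetP.
Qed.

(** * Patterns, full blocks and refinements *)

Fixpoint lang (s : seq factor) w : Prop :=
  match s with
  | [::] => w = [::]
  | inl a :: s' => exists2 w', w = a :: w' & lang s' w'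
  | inr C :: s' => exists y w', [/\ w = y ++ w', {subset y <= C} & lang s' w']
  end.

Fixpoint blocks N C w : Prop :=
  if N is N'.+1 then exists b w', [/\ w = b ++ w', b =i C & blocks N' C w']
  else {subset w <= C}.

Fixpoint full N (s : seq factor) w : Prop :=
  match s with
  | [::] => w = [::]
  | inl a :: s' => exists2 w', w = a :: w' & full N s' w'
  | inr C :: s' => exists y w', [/\ w = y ++ w', blocks N C y & full N s' w']
  end.

(** The ways a word over [C] can fail to have [N] full blocks. Either it misses a letter [a], or its
    shortest prefix of full content is a word over [C :\ a] followed by [a], and the failure occurs
    in the rest. *)
Fixpoint pieces N C : seq (seq factor) :=
  if N is N'.+1 then
    [seq [:: inr (C :\ a)] | a <- enum C] ++
    [seq [:: inr (C :\ a), inl a & r] | a <- enum C, r <- pieces N' C]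
  else [::].

Fixpoint refine N (s : seq factor) : seq (seq factor) :=
  match s with
  | [::] => [::]
  | inl a :: s' => map (cons (inl a)) (refine N s')
  | inr C :: s' => map (cons (inr C)) (refine N s') ++ [seq r ++ s' | r <- pieces N C]
  end.

Lemma lang_cat s1 s2 w1 w2 : lang s1 w1 -> lang s2 w2 -> lang (s1 ++ s2) (w1 ++ w2).
Proof.
elim: s1 w1 => [|[a|C] s1 IH] w1 /=; first by move=> ->.
  by case=> w' -> /IH h /h ?; exists (w' ++ w2).
by case=> y [w' [-> yC /IH h /h ?]]; exists y, (w' ++ w2); rewrite -catA.
Qed.

(** The shortest prefix of full content is nonempty as [C] is, and by minimality its last letter has
    not occurred before. *)
Lemma first_full_prefix C w : C != set0 -> {subset C <= w} ->
  exists w1 a w2, [/\ w = w1 ++ a :: w2, a \in C, a \notin w1 & {subset C <= rcons w1 a}].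
Proof.
move=> C0; elim/last_ind: w => [|w b IH] Cw.
  by case/set0Pn: C0 => a /Cw.
have [/IH [w1 [a [w2 [-> aC aw1 Cw1]]]]|Cnw] := pselect {subset C <= w}.
  by exists w1, a, (rcons w2 b); rewrite rcons_cat.
exists w, b, [::]; rewrite cats1; split => //.
  apply: contrapT => bC; apply: Cnw => c cC; have := Cw c cC.
  by rewrite mem_rcons inE => /orP [/eqP cb|//]; case: bC; rewrite -cb.
apply/negP => bw; apply: Cnw => c /Cw; rewrite mem_rcons inE => /orP [/eqP -> //|//].
Qed.

Lemma blocks_or_pieces N C w : {subset w <= C} ->
  blocks N C w \/ exists2 r, r \in pieces N C & lang r w.
Proof.
elim: N w => [|N IH] w wC; first by left.
have [Cw|] := pselect {subset C <= w}; last first.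
  move=> /existsPNP [a aC aw]; right; exists [:: inr (C :\ a)].
    by rewrite mem_cat; apply/orP; left; apply/mapP; exists a; rewrite // mem_enum.
  exists w, [::]; rewrite cats0; split => // b bw.
  by rewrite !inE wC // andbT; apply/negP => /eqP ba; apply: aw; rewrite -ba.
have [C0|C0] := eqVneq C set0.
  left; move: wC; rewrite {}C0 => w0 {IH Cw}; have -> : w = [::].
    by case: w w0 => // a w /(_ a); rewrite mem_head inE => /(_ isT).
  elim: N.+1 => [|n IH] //=; exists [::], [::]; split=> // a; by rewrite inE.
have [w1 [a [w2 [E aC aw1 Cw1]]]] := first_full_prefix C0 Cw.
have w1C b : b \in w1 -> b \in C by move=> bw; apply: wC; rewrite E mem_cat bw.
have [|b2|[r rp lr]] := IH w2.
- by move=> b bw; apply: wC; rewrite E mem_cat inE bw !orbT.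
- left; exists (rcons w1 a), w2; split => //; first by rewrite cat_rcons.
  move=> b; apply/idP/idP; last exact: Cw1.
  by rewrite mem_rcons inE => /orP [/eqP -> //|/w1C].
right; exists [:: inr (C :\ a), inl a & r].
  rewrite mem_cat; apply/orP; right; apply/allpairsP; exists (a, r).
  by rewrite mem_enum.
exists w1, (a :: w2); split => //; last by exists w2.
by move=> b bw; rewrite !inE w1C // andbT; apply/negP => /eqP ba; rewrite -ba bw in aw1.
Qed.

Lemma full_or_refine N s w : lang s w ->
  full N s w \/ exists2 s', s' \in refine N s & lang s' w.
Proof.
elim: s w => [|[a|C] s IH] w /=; first by left.
  case=> w' -> /IH [fw|[s' s'r ls']]; first by left; exists w'.
  right; exists (inl a :: s'); first by rewrite map_f.
  by exists w'.
case=> y [w' [-> yC lw]]; case: (IH _ lw) => [fw|[s' s'r ls']]; last first.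
  right; exists (inr C :: s'); first by rewrite mem_cat map_f.
  by exists y, w'.
case: (blocks_or_pieces N yC) => [by_|[r rp lr]]; first by left; exists y, w'.
right; exists (r ++ s); last exact: lang_cat.
by rewrite mem_cat; apply/orP; right; exact: (map_f (cat^~ s)).
Qed.

(** * Termination of refinement and existence of normal forms *)

Definition frank (x : factor) : nat := if x is inr C then #|C|.+1 else 0.

(* The multiset order on ranks, hence well-founded. *)
Definition rstep (s' s : seq factor) : Prop := exists p x q r,
  [/\ s = p ++ x :: q, s' = p ++ r ++ q & all (fun y => frank y < frank x) r].

Lemma rstep_cons x s s' : rstep s' s -> rstep (x :: s') (x :: s).
Proof. by case=> p [y [q [r [-> -> h]]]]; exists (x :: p), y, q, r. Qed.

(** Prepending a factor preserves accessibility, by induction on a bound for its rank and then on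
    the accessibility of the tail. If the factor itself is replaced, its substitutes have smaller
    rank and are prepended one by one. *)
Lemma rstep_acc s : Acc rstep s.
Proof.
suff H : forall n x, frank x < n -> forall s, Acc rstep s -> Acc rstep (x :: s).
  elim: s => [|x s IH]; last exact: H (ltnSn _) _ IH.
  by constructor=> s' [[|? ?] [? [? [? []]]]].
elim=> [//|n IHn] x xn {}s; elim=> {}s As IHs.
constructor => s' [[|y p] [z [q [r [/= [<- E] -> rz]]]]]; last first.
  by apply: IHs; exists p, z, q, r.
rewrite -{q}E; elim: r rz => [_|y r IHr /= /andP [yx rx]] /=; first by constructor.
by apply: (IHn y); [exact: leq_trans yx xn | exact: IHr].
Qed.

Lemma refine_rstep N s s' : s' \in refine N s -> rstep s' s.
Proof.
elim: s s' => [|[a|C] s IH] s' //=.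
  by move=> /mapP [t /IH h ->]; exact: rstep_cons.
rewrite mem_cat => /orP [/mapP [t /IH h ->]|/mapP [r rp ->]]; first exact: rstep_cons.
exists [::], (inr C), s, r; split => //; elim: N r rp {IH} => // N IHN r.
have CD a : a \in C -> frank (inr (C :\ a)) < frank (inr C).
  by move=> aC; rewrite ltnS [X in _ < X](cardsD1 a) aC.
rewrite mem_cat => /orP [/mapP [a]|/allpairsP [[a t] /= [aC tp ->]]].
  by rewrite mem_enum => aC ->; rewrite /= andbT; exact: CD.
by rewrite mem_enum in aC; rewrite /= CD // IHN.
Qed.

Lemma blocks_sub N C w : blocks N C w -> {subset w <= C}.
Proof.
elim: N w => //= N IH w [b [w' [-> bC /IH w'C]]] a.
by rewrite mem_cat bC => /orP [|/w'C].
Qed.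

(** Here [p i] is the concatenation of the first [i] blocks, so the gap between two of these
    prefixes contains a full block. *)
Lemma blocks_prefix N C w : blocks N C w -> exists2 p : nat -> seq A,
  forall i, i <= N -> exists2 r, w = p i ++ r & {subset r <= C} &
  forall i j, i < j <= N -> exists2 q, p j = p i ++ q & q =i C.
Proof.
elim: N w => [|N IH] w /=.
  exists (fun _ => [::]) => [i _|i j /andP [ij]]; first by exists w.
  by rewrite leqn0 => /eqP j0; rewrite j0 in ij.
case=> b [w' [-> bC bw']]; have [p p1 p2] := IH _ bw'.
have w'C := blocks_sub bw'.
exists (fun i => if i is k.+1 then b ++ p k else [::]).
  case=> [|i] iN; first exists (b ++ w') => //.
    by move=> a; rewrite mem_cat bC => /orP [|/w'C].
  by have [r -> rC] := p1 i iN; exists r; rewrite // catA.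
case=> [|i] [|j] //; rewrite !ltnS => ijN; last first.
  by have [q -> qC] := p2 i j ijN; exists q; rewrite // catA.
exists (b ++ p j) => // a; rewrite mem_cat bC; case aC: (a \in C) => //=.
have [r E _] := p1 j ijN; apply/negbTE/negP => ap; move: (w'C a).
by rewrite E mem_cat ap aC => /(_ isT).
Qed.

(* Two of the values of the |T| + 1 prefixes ending at block boundaries coincide,
   which creates an idempotent in T. *)
Lemma blocks_omega (T : finMonoid) (f : A -> T) C w : blocks #|T| C w ->
  exists2 z, z ~~~ fval (inr C) & omg_op z T f = wev f w.
Proof.
move=> bw; have [p p1 p2] := blocks_prefix bw.
have /injectivePn [i [j]] : ~~ injectiveb (fun i : 'I_(#|T|).+1 => wev f (p i)).
  by apply/negP => /injectiveP /leq_card; rewrite card_ord ltnn.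
wlog ij : i j / i < j => [W nij Eij|_ Eij].
  case: (ltngtP i j) => h; first exact: (W i j).
    by apply: (W j i) => //; rewrite eq_sym.
  by move: nij; rewrite (val_inj h) eqxx.
have jN : j <= #|T| by rewrite -ltnS.
have [|q Eq qC] := p2 i j; first by rewrite ij.
have [r -> rC] := p1 i (ltnW (leq_trans ij jN)).
have pC : {subset p i <= C}.
  by move=> a ap; apply: (blocks_sub bw); have [r' -> _] := p1 i (ltnW (leq_trans ij jN)); rewrite mem_cat ap.
(* The gap q has content [C], so q^ω absorbs both [p i] and [r]. *)
exists (omul (omul (oword (p i)) (oomega (oword q))) (oword r)).
  have qE : q =i enum C by move=> a; rewrite mem_enum qC.
  have [|-> _] := @word_absorb (p i) q; first by move=> a /pC; rewrite qC.
  have [|_ ->] := @word_absorb r q; first by move=> a /rC; rewrite qC.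
  exact: omega_content.
rewrite /= !oword_op wev_cat; congr fm_mul.
(* From x = x y follows x = x y^n for all n, so inserting q^ω after [p i] leaves the value in [T]
   unchanged. *)
move: Eij; rewrite Eq wev_cat; move: (wev f (p i)) (wev f q) => x y xy.
by rewrite /fomega; elim: (_`!) => [|n IH]; rewrite ?fm_mul1r //= fm_mulA -xy.
Qed.

Lemma full_nfval (T : finMonoid) (f : A -> T) s w : full #|T| s w ->
  exists2 z, z ~~~ nfval s & omg_op z T f = wev f w.
Proof.
elim: s w => [|[a|C] s IH] w /=.
- by move=> ->; exists (oone A) => //; reflexivity.
- by case=> w' -> /IH [z zs Ez]; exists (omul (oletter a) z); rewrite /= ?Ez ?zs //; reflexivity.
- case=> y [w' [-> /(blocks_omega f) [z1 z1C E1] /IH [z zs Ez]]].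
  by exists (omul z1 z); rewrite ?z1C ?zs ?wev_cat /= ?E1 ?Ez //; reflexivity.
Qed.

Lemma exists_nfval_of_lang s u : dense (lang s) u -> exists s', u ~~~ nfval s'.
Proof.
elim: (rstep_acc s) u => {}s _ IH u ds.
have [fu|nf] := pselect (forall (T : finMonoid) (f : A -> T),
    exists w, full #|T| s w /\ wev f w = omg_op u T f).
  (* Full matches exist for every [T]: the elements [z] they provide converge to [u] and are
     provably equal to [nfval s]. *)
  exists s; apply: prov_closure => T f; have [w [/(full_nfval f) [z zs Ez] Ew]] := fu T f.
  by exists z, (nfval s); rewrite Ez.
have [T0 [f0 H0]] : exists (T : finMonoid) (f : A -> T), forall w,
    full #|T| s w -> wev f w <> omg_op u T f.
  apply: contrapT => H; apply: nf => T f; apply: contrapT => H'.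
  by apply: H; exists T, f => w fw E; apply: H'; exists w.
(* Words matching [s] that agree with [u] at [f0] are not full, so they match a refinement; one of
   the finitely many refinements stays dense. *)
have [|s' /refine_rstep/IH h /h //] := @dense_exists A (seq factor) (refine #|T0| s) lang u.
move=> T f; have [w [lw E0 E]] := dense_pair f0 f ds; exists w; split => //.
by case: (full_or_refine #|T0| lw) => // /H0.
Qed.

Definition nonempty_factor (x : factor) : bool := if x is inr C then C != set0 else true.

Lemma exists_nfval u : exists2 s, u ~~~ nfval s & all nonempty_factor s.
Proof.
have [|s us] := @exists_nfval_of_lang [:: inr [set: A]] u.
  move=> T f; have [w [_ E]] := dense_words u f; exists w; split => //.
  by exists w, [::]; rewrite cats0; split => // a; rewrite inE.
(* Factors of empty content have value 1 and are dropped, so that every remaining factor has a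
   nonempty expansion for positive exponents. *)
exists (filter nonempty_factor s); last exact: filter_all.
rewrite us; elim: s {us} => [|x s IH] /=; first by reflexivity.
case: ifP => [_ /=|]; first by rewrite IH; reflexivity.
case: x => [a|C] //= /negbFE/eqP ->; rewrite enum_set0 IH /=.
suff -> : oomega (oone A) = oone A by rewrite omul1l; reflexivity.
apply: omega_ext => T f /=; rewrite /fomega.
by elim: (_`!) => //= n ->; exact: fm_mul1l.
Qed.

(** * Mutually embeddable normal forms are provably equal *)

Implicit Types s t p q : seq factor.

(* Several consecutive factors may be mapped to the same set factor. *)
Inductive emb : seq factor -> seq factor -> Prop :=
  | EmbNil t : emb [::] t
  | EmbSkip s y t : emb s t -> emb s (y :: t)
  | EmbAbsorb x s C t : fle C x -> emb s (inr C :: t) -> emb (x :: s) (inr C :: t)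
  | EmbLetter a s t : emb s t -> emb (inl a :: s) (inl a :: t).

Lemma emb_cons x s : emb s s -> emb (x :: s) (x :: s).
Proof.
by case: x => [a|C] ss; [exact: EmbLetter | apply: EmbAbsorb => //=; exact: EmbSkip].
Qed.

Lemma emb_refl s : emb s s.
Proof. by elim: s => [|x s IH]; [exact: EmbNil | exact: emb_cons]. Qed.

Lemma fle_trans C (D : {set A}) x : D \subset C -> fle D x -> fle C x.
Proof. by case: x => [a|E] /= DC; [exact: (subsetP DC) | move=> /subset_trans; apply]. Qed.

Lemma emb_trans s t r : emb s t -> emb t r -> emb s r.
Proof.
move=> st tr; elim: tr s st => {t r} [t|t y r _ IH|x t C r xC tr IH|a t r _ IH] s st.
- by inversion st; exact: EmbNil.
- by apply: EmbSkip; exact: IH.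
(* Several factors of [s] may be mapped to the head [x], which calls for an inner induction on the
   first embedding. *)
- move E: (x :: t) st => t' st.
  elim: st E => {s t'} [t'|s y t' st _|y s D t' yD _ IHs|a s t' st _] E.
  + exact: EmbNil.
  + by case: E => _ Et; apply: IH; rewrite Et.
  + apply: EmbAbsorb; last exact: IHs E.
    by apply: fle_trans yD; case: E xC => ->.
  + by case: E => Ex Et; apply: EmbAbsorb; [rewrite Ex in xC | apply: IH; rewrite Et].
- inversion st; subst; first exact: EmbNil.
    by apply: EmbSkip; exact: IH.
  by apply: EmbLetter; exact: IH.
Qed.

Lemma emb_consl x s t : emb (x :: s) t -> emb s t.
Proof. by apply: emb_trans; apply: EmbSkip; exact: emb_refl. Qed.

Lemma emb_absorb C p s t : all (fle C) p -> emb s t -> emb (p ++ s) (inr C :: t).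
Proof.
move=> + st; elim: p => [_|x p IH /andP [xC /IH pC]]; first exact: EmbSkip.
exact: EmbAbsorb.
Qed.

Lemma emb_inr_head C s t : ((if s is x :: _ then ~~ fle C x else true) : bool) ->
  emb s (inr C :: t) -> emb s t.
Proof.
by move=> h e; inversion e; subst => //; [exact: EmbNil | move: h; rewrite H2].
Qed.

Lemma emb_inv x s y t : emb (x :: s) (y :: t) ->
  [\/ emb (x :: s) t,
      exists C, [/\ y = inr C, fle C x & emb s (y :: t)] |
      exists a, [/\ x = inl a, y = inl a & emb s t]].
Proof.
by move=> e; inversion e; subst; [constructor 1 | constructor 2; exists C | constructor 3; exists a].
Qed.

Lemma nfval_absorbl C x s : fle C x -> nfval (x :: inr C :: s) ~~~ nfval (inr C :: s).
Proof.
by move=> /factor_absorb [E _]; rewrite /= omulA E; reflexivity.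
Qed.

Lemma nfval_absorbr C x s : fle C x -> nfval (inr C :: x :: s) ~~~ nfval (inr C :: s).
Proof.
by move=> /factor_absorb [_ E]; rewrite /= omulA E; reflexivity.
Qed.

(** Factors right after the two heads that [C] absorbs are removed one at a time, shortening the
    pair. Once none is left, neither head [C] can receive a factor of the other tail, so the tails
    embed into each other. *)
Lemma emb_nfval_inr C s t :
  (forall s' t', size s' + size t' < (size s + size t).+2 ->
     emb s' t' -> emb t' s' -> nfval s' ~~~ nfval t') ->
  emb (inr C :: s) (inr C :: t) -> emb (inr C :: t) (inr C :: s) ->
  nfval (inr C :: s) ~~~ nfval (inr C :: t).
Proof.
have drop x r : fle C x -> emb (inr C :: r) (inr C :: x :: r) /\
    emb (inr C :: x :: r) (inr C :: r).
  move=> xC; split; do ?[apply: EmbAbsorb => //=; try exact: emb_refl].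
    by do 2!apply: EmbSkip; exact: emb_refl.
  by apply: EmbSkip; exact: emb_refl.
move=> IH st ts.
have [[x [s' [Es xC]]]|hs] : (exists x s', s = x :: s' /\ fle C x) \/
    ((if s is x :: _ then ~~ fle C x else true) : bool).
- case: s {IH st ts} => [|x s]; first by right.
  by case xC: (fle C x); [left; exists x, s | right].
- move: st ts IH; rewrite {}Es => st ts IH; have [e1 e2] := drop x s' xC.
  rewrite nfval_absorbr //; apply: IH; first by rewrite /= !addSn addnS.
    exact: emb_trans e1 st.
  exact: emb_trans ts e2.
have [[x [t' [Et xC]]]|ht] : (exists x t', t = x :: t' /\ fle C x) \/
    ((if t is x :: _ then ~~ fle C x else true) : bool).
- case: t {IH st ts} => [|x t]; first by right.
  by case xC: (fle C x); [left; exists x, t | right].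
- move: st ts IH; rewrite {}Et => st ts IH; have [e1 e2] := drop x t' xC.
  rewrite (nfval_absorbr _ xC); apply: IH; first by rewrite /= !addSn !addnS.
    exact: emb_trans st e2.
  exact: emb_trans e1 ts.
have := IH s t; rewrite ltnS leqnSn => /(_ isT) E.
rewrite /= E; first by reflexivity.
- by apply: (emb_inr_head hs); exact: emb_consl st.
- by apply: (emb_inr_head ht); exact: emb_consl ts.
Qed.

(** Induction on the total length, with nine cases according to how each embedding treats the two
    heads. *)
Lemma emb_nfval s t : emb s t -> emb t s -> nfval s ~~~ nfval t.
Proof.
have [n] := ubnP (size s + size t); elim: n s t => // n IH s t; rewrite ltnS.
case: s t => [|x s] [|y t] stn st ts; first by reflexivity.
- by inversion ts.
- by inversion st.
have hl s' t' : size s' <= size s -> size t' <= (size t).+1 -> emb s' t' -> emb t' s' ->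
    nfval s' ~~~ nfval t'.
  by move=> h1 h2; apply: IH; apply: leq_trans stn; rewrite /= addSn ltnS leq_add.
have hr s' t' : size s' <= (size s).+1 -> size t' <= size t -> emb s' t' -> emb t' s' ->
    nfval s' ~~~ nfval t'.
  by move=> h1 h2; apply: IH; apply: leq_trans stn; rewrite /= addnS ltnS leq_add.
have xs := emb_consl st; have yt := emb_consl ts.
have [st'|[C [yC xC st']]|[a [xa ya st']]] := emb_inv st;
  have [ts'|[D [xD yD ts']]|[b [yb xb ts']]] := emb_inv ts.
(* Both heads are skipped, so [s], [t], [x :: s] and [y :: t] all embed into one another; the chain
   uses only shorter pairs. *)
- transitivity (nfval t); first exact: hr.
  transitivity (nfval s); last exact: hl.
  apply: provable_sym => //; apply: hl => //; first exact: emb_consl st'.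
  exact: emb_consl ts'.
(* Since [x] absorbs [y], put [y] in front of [x :: s]; it remains to compare [x :: s] with [t]. *)
- rewrite xD -(nfval_absorbl _ yD) -xD.
  have E : nfval (x :: s) ~~~ nfval t by exact: hr.
  exact: provable_mull E.
- by rewrite xb yb /= (hl s t) //; [reflexivity | exact: emb_consl st'].
- rewrite yC -(nfval_absorbl _ xC) -yC.
  have E : nfval s ~~~ nfval (y :: t) by exact: hl.
  exact: provable_mull E.
- have CD : D = C.
    by apply/eqP; rewrite eqEsubset; move: xC yD; rewrite xD yC /= => -> ->.
  rewrite xD yC CD; apply: emb_nfval_inr; last by rewrite -{1}yC -CD -xD.
    by move=> s' t' h; apply: IH; apply: leq_trans stn; rewrite /= addSn addnS.
  by rewrite -{2}yC -CD -xD.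
- by rewrite yC in yb.
- by rewrite xa ya /= (hl s t) //; [reflexivity | exact: emb_consl ts'].
- by rewrite xa in xD.
- by rewrite xa ya /= (hl s t) //; reflexivity.
Qed.

(** * Expanding normal forms into words *)

Definition fexpand n (x : factor) : seq A :=
  match x with inl a => [:: a] | inr C => wpow n (enum C) end.

Definition expand n s : seq A := flatten (map (fexpand n) s).

Lemma expand_cons n x s : expand n (x :: s) = fexpand n x ++ expand n s.
Proof. by []. Qed.

Lemma wpowD m n w : wpow (m + n) w = wpow m w ++ wpow n w.
Proof. by elim: m => //= m IH; rewrite /wpow /= -catA -/(wpow _ _) IH. Qed.

Lemma wpow1 w : wpow 1 w = w.
Proof. by rewrite /wpow /= cats0. Qed.

Lemma expand_subseq k n s : subseq (expand n s) (expand (k + n) s).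
Proof.
elim: s => // x s IH; rewrite !expand_cons; apply: cat_subseq => //.
by case: x => [a|C]; rewrite /fexpand ?wpowD ?suffix_subseq.
Qed.

Lemma cat_eq_split (x1 x2 y1 y2 : seq A) : x1 ++ x2 = y1 ++ y2 -> size y1 <= size x1 ->
  exists2 z, x1 = y1 ++ z & y2 = z ++ x2.
Proof.
elim: y1 x1 => [|b y1 IH] [|a x1] //= E; try by exists [::].
  by exists (a :: x1).
by case: E => <- /IH h /h [z -> ->]; exists z.
Qed.

(** The cut meets at most one factor. A power of exponent [k + n] leaves [k] copies to the left of
    the cut or [n] copies to the right, which decides the side of its factor. *)
Lemma expand_split k n s x1 x2 : x1 ++ x2 = expand (k + n) s ->
  exists p q, [/\ s = p ++ q, subseq (expand k p) x1 & subseq (expand n q) x2].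
Proof.
elim: s x1 x2 => [|[a|C] s IH] x1 x2.
- by move=> _; exists [::], [::]; rewrite !sub0seq.
- rewrite expand_cons; case: x1 => [|b x1] /= E.
    exists [::], (inl a :: s); split=> //.
    rewrite E /=; exact: (@cat_subseq _ [:: a] _ [:: a] _ (subseq_refl _) (expand_subseq k n s)).
  case: E => -> /IH [p [q [-> px qx]]]; exists (inl a :: p), q; split=> //.
  exact: (@cat_subseq _ [:: a] _ [:: a] _ (subseq_refl _) px).
rewrite expand_cons /= wpowD -catA => E.
have [kx|kx] := leqP (size (wpow k (enum C))) (size x1); last first.
  have [z E1 ->] := cat_eq_split (esym E) (ltnW kx).
  exists [::], (inr C :: s); rewrite sub0seq; split=> //.
  apply: subseq_trans (suffix_subseq _ _).
  by apply: cat_subseq => //; exact: expand_subseq.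
have [z -> E1] := cat_eq_split E kx.
have [nz|nz] := leqP (size (wpow n (enum C))) (size z).
  have [z' -> /esym/IH [p [q [-> px qx]]]] := cat_eq_split (esym E1) nz.
  exists (inr C :: p), q; split=> //; apply: cat_subseq => //.
  by apply: subseq_trans (suffix_subseq _ _).
have [z' _ ->] := cat_eq_split E1 (ltnW nz).
exists [:: inr C], s; split=> //; first by rewrite expand_cons cats0 prefix_subseq.
by apply: subseq_trans (suffix_subseq _ _); exact: expand_subseq.
Qed.

Lemma subseq_catP (x y z : seq A) : subseq x (y ++ z) ->
  exists x1 x2, [/\ x = x1 ++ x2, subseq x1 y & subseq x2 z].
Proof.
case/subseqP => m; rewrite size_cat => sm ->; exists (mask (take (size y) m) y).
exists (mask (drop (size y) m) z); rewrite !mask_subseq; split => //.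
by rewrite -{1}(cat_take_drop (size y) m) mask_cat // size_take_min sm; apply/minn_idPl/leq_addr.
Qed.

Lemma expand_fle k C p : {subset expand k.+1 p <= C} -> all (fle C) p.
Proof.
elim: p => //= x p IH; rewrite expand_cons => xC; apply/andP; split; last first.
  by apply: IH => a ap; apply: xC; rewrite mem_cat ap orbT.
case: x xC => [a|D] xC /=; first by apply: xC; rewrite mem_head.
by apply/subsetP => a aD; apply: xC; rewrite /fexpand (wpowD 1) wpow1 !mem_cat mem_enum aD.
Qed.

Lemma size_fexpand k x : nonempty_factor x -> (if x is inr _ then k else 1) <= size (fexpand k x).
Proof.
case: x => [a|C] //= C0; rewrite size_flatten /shape map_nseq sumn_nseq.
by rewrite leq_pmull // -cardE card_gt0.
Qed.

(** Each factor of [t] uses up two copies in the exponent of [s]: two are enough to make a set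
    factor too long for a single letter. The final 1 keeps expansions nonempty when [t] is
    exhausted. *)
Lemma expand_emb m s t : all nonempty_factor s ->
  subseq (expand ((size t).*2.+1) s) (expand m t) -> emb s t.
Proof.
elim: t s => [|y t IH] s s0.
  case: s s0 => [|x s]; first by constructor.
  rewrite expand_cons => /andP [/(size_fexpand 1)]; rewrite subseq0.
  by case: (fexpand 1 x) => //; case: (x).
rewrite expand_cons /= => /subseq_catP [x1 [x2 [E sy st]]].
have [p [q [Es px qx]]] := @expand_split 2 (size t).*2.+1 s x1 x2 (esym E).
move: s0; rewrite Es all_cat => /andP [p0 q0].
have qt : emb q t by apply: IH => //; exact: subseq_trans qx st.
have {px sy} py := subseq_trans px sy.
case: y {E} py => [b|D] py; last first.
  apply: emb_absorb => //; apply: (@expand_fle 1) => a /(mem_subseq py) /mem_wpow.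
  by rewrite mem_enum.
(* The expansion of [p] has length at most 1, whereas a set factor contributes at least 2; so [p] is
   empty or the single letter [b]. *)
have := size_subseq py; case: p p0 py {Es} => [|x p] //=; first by constructor.
case/andP => /(size_fexpand 2); rewrite expand_cons size_cat.
case: x => [a|C] /= x0 p0 py; last first.
  by move=> h; have := leq_trans (leq_trans x0 (leq_addr _ _)) h.
case: p p0 py => [|x p] /=; first by case: (a =P b) => [->|] // _ _ _; exact: EmbLetter.
case/andP => /(size_fexpand 2); rewrite expand_cons size_cat => x1' _ _.
by case: x x1' => [c|C] /=; case: (size _).
Qed.

End NormalForms.

(** * Ordered finite monoids with least element 1 satisfy both sets *)

Section OrderedMonoid.
Variables (T : finMonoid) (le : rel T).
Hypotheses (le_refl : reflexive le) (le_anti : antisymmetric le) (le_trans : transitive le).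
Hypothesis le1 : forall x, le fm_one x.
Hypothesis le_mul : forall x y x' y', le x x' -> le y y' -> le (fm_mul x y) (fm_mul x' y').
Implicit Types x y e : T.

Lemma le_mull x y : le x (fm_mul x y).
Proof. by rewrite -{1}(fm_mul1r x); apply: le_mul. Qed.

Lemma le_mulr x y : le x (fm_mul y x).
Proof. by rewrite -{1}(fm_mul1l x); apply: le_mul. Qed.

Lemma le_fomega x : le x (fomega x).
Proof. by rewrite /fomega -(prednK (fact_gt0 _)); exact: le_mull. Qed.

Lemma le_fpow_idem x e n : fm_mul e e = e -> le x e -> le (fpow x n) e.
Proof.
move=> ee xe; elim: n => [|n IH]; first exact: le1.
by rewrite -ee; apply: le_mul.
Qed.

(** Sandwich: e ≤ e x ≤ e e = e, and likewise on the other side. *)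
Lemma idem_absorb x e : fm_mul e e = e -> le x e -> fm_mul e x = e /\ fm_mul x e = e.
Proof.
move=> ee xe; split; apply: le_anti.
  by rewrite le_mull -{2}ee le_mul.
by rewrite le_mulr -{2}ee le_mul.
Qed.

Lemma le_fpow_fomega x n : le (fpow x n) (fomega x).
Proof. by apply: le_fpow_idem; [exact: fomega_idem | exact: le_fomega]. Qed.

Lemma le_fomega_mul x y : le x (fomega (fm_mul x y)) /\ le y (fomega (fm_mul x y)).
Proof.
split; apply: le_trans (le_fomega _); [exact: le_mull | exact: le_mulr].
Qed.

Lemma ordered_models_Sigma : models T SigmaSet.
Proof.
(* Both factors of y x lie below the idempotent (x y)^ω, hence so does every power of y x. *)
have H x y : le (fomega (fm_mul y x)) (fomega (fm_mul x y)).
  have [hx hy] := le_fomega_mul x y; apply: le_fpow_idem; first exact: fomega_idem.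
  by rewrite -fomega_idem; apply: le_mul.
move=> p [->|->] f /=; last by apply: le_anti; rewrite !H.
by have [] := idem_absorb (fomega_idem _) (le_fomega (f (@Ordinal 2 0 isT))).
Qed.

Lemma ordered_models_Gamma : models T GammaSet.
Proof.
move=> p [->|->] f /=; set x := f _; set y := f _; have [hx hy] := le_fomega_mul x y.
  by have [] := idem_absorb (fomega_idem _) hx.
by have [_ ->] := idem_absorb (fomega_idem _) hy.
Qed.

Lemma wev_expand_le (A : finType) (f : A -> T) n (s : seq (factor A)) :
  le (wev f (expand n s)) (omg_op (nfval s) T f).
Proof.
elim: s => [|x s IH] /=; first exact: le_refl.
rewrite expand_cons wev_cat; apply: le_mul => //.
case: x => [a|C] /=; first by rewrite fm_mul1r.
by rewrite wev_wpow oword_op; exact: le_fpow_fomega.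
Qed.

End OrderedMonoid.

Lemma omg_nfval (A : finType) (T : finMonoid) (f : A -> T) (s : seq (factor A)) :
  omg_op (nfval s) T f = wev f (expand (#|T|)`! s).
Proof.
elim: s => //= x s IH; rewrite expand_cons wev_cat IH; congr fm_mul.
case: x => [a|C] /=; first by rewrite fm_mul1r.
by rewrite wev_wpow oword_op.
Qed.

(** * Monotone inflationary maps of a finite chain *)

Section InflationaryMaps.
Variable n : nat.

Definition inflationary (f : {ffun 'I_n.+1 -> 'I_n.+1}) : bool :=
  [forall i : 'I_n.+1, i <= f i] &&
  [forall i : 'I_n.+1, forall j : 'I_n.+1, (i <= j) ==> (f i <= f j)].

Definition infl_type := {f : {ffun 'I_n.+1 -> 'I_n.+1} | inflationary f}.

Lemma inflationaryP (f : {ffun 'I_n.+1 -> 'I_n.+1}) :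
  reflect ((forall i : 'I_n.+1, i <= f i) /\ (forall i j : 'I_n.+1, i <= j -> f i <= f j)) (inflationary f).
Proof.
apply: (iffP andP) => -[h1 h2]; split.
- exact/forallP.
- by move=> i j; move/forallP: h2 => /(_ i) /forallP /(_ j) /implyP.
- exact/forallP.
- by apply/forallP => i; apply/forallP => j; apply/implyP; exact: h2.
Qed.

Lemma infl_id_subproof : inflationary [ffun i => i].
Proof. by apply/inflationaryP; split=> [i|i j]; rewrite !ffunE. Qed.

Lemma infl_comp_subproof (f g : infl_type) : inflationary [ffun i => val g (val f i)].
Proof.
case: f g => [f /= /inflationaryP [f1 f2]] [g /= /inflationaryP [g1 g2]].
apply/inflationaryP; split=> [i|i j ij]; rewrite !ffunE.
  exact: leq_trans (f1 i) (g1 _).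
exact/g2/f2.
Qed.

Definition infl_id : infl_type := Sub [ffun i => i] infl_id_subproof.
(** The left factor acts first, so that words are read from left to right. *)
Definition infl_comp (f g : infl_type) : infl_type :=
  Sub [ffun i => val g (val f i)] (infl_comp_subproof f g).

Lemma infl_compA : associative infl_comp.
Proof. by move=> f g h; apply/val_inj/ffunP => i; rewrite !ffunE. Qed.
Lemma infl_comp1l : left_id infl_id infl_comp.
Proof. by move=> f; apply/val_inj/ffunP => i; rewrite !ffunE. Qed.
Lemma infl_comp1r : right_id infl_id infl_comp.
Proof. by move=> f; apply/val_inj/ffunP => i; rewrite !ffunE. Qed.

Definition infl_monoid := @FinMonoid infl_type _ _ infl_compA infl_comp1l infl_comp1r.

Definition infl_le : rel infl_monoid := fun f g : infl_type => [forall i, val f i <= val g i].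

Lemma infl_le_refl : reflexive infl_le.
Proof. by move=> f; apply/forallP. Qed.

Lemma infl_le_anti : antisymmetric infl_le.
Proof.
move=> f g /andP [/forallP fg /forallP gf]; apply/val_inj/ffunP => i.
by apply/val_inj/eqP; rewrite eqn_leq fg gf.
Qed.

Lemma infl_le_trans : transitive infl_le.
Proof.
by move=> g f h /forallP fg /forallP gh; apply/forallP => i; exact: leq_trans (fg i) (gh i).
Qed.

Lemma infl_le1 f : infl_le fm_one f.
Proof.
by apply/forallP => i; rewrite ffunE; case: f => f /= /inflationaryP [].
Qed.

Lemma infl_le_mul f g f' g' :
  infl_le f f' -> infl_le g g' -> infl_le (fm_mul f g) (fm_mul f' g').
Proof.
move=> /forallP ff /forallP gg; apply/forallP => i; rewrite !ffunE.
apply: leq_trans (gg _); case: g {gg} => g /= /inflationaryP [_]; exact.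
Qed.

End InflationaryMaps.

(** * Detecting subwords with inflationary maps *)

Section SubwordAutomaton.
Variables (A : finType) (x : seq A).
Local Notation n := (size x).

(* State i records that the first i letters of x have been read, greedily, as a subword. *)
Definition scan_fun (a : A) (i : 'I_n.+1) : 'I_n.+1 :=
  inord (i + ((i < n) && (nth a x i == a))).

Lemma scan_funE a i : scan_fun a i = i + ((i < n) && (nth a x i == a)) :> nat.
Proof.
rewrite inordK //; case: (ltnP i n) => [ltin|_]; last by rewrite /= addn0 ltn_ord.
by case: (_ == _); rewrite /= ?addn0 ?addn1 // ltnS ltnW.
Qed.

Lemma scan_subproof a : inflationary [ffun i => scan_fun a i].
Proof.
apply/inflationaryP; split=> [i|i j]; rewrite !ffunE !scan_funE ?leq_addr //.
rewrite leq_eqVlt => /orP [/eqP ->//|ij]; apply: leq_trans (leq_addr _ _).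
by apply: leq_trans ij; rewrite -[X in _ <= X]addn1 leq_add2l leq_b1.
Qed.

Definition scan a : infl_monoid n := (Sub [ffun i => scan_fun a i] (scan_subproof a) : infl_type n).

Lemma subseq_scan w (i : 'I_n.+1) :
  subseq (drop i x) w = (val (wev scan w : infl_type n) i == n :> nat).
Proof.
elim: w i => [|a w IH] i /=.
  by rewrite ffunE -size_eq0 size_drop subn_eq0 eqn_leq -(ltnS i) ltn_ord.
rewrite ffunE -IH /= ffunE scan_funE.
have [ltin|leni] := ltnP i n; last by rewrite /= addn0 drop_oversize // sub0seq.
by rewrite (drop_nth a ltin) /=; case: eqP => _; rewrite ?addn1 ?addn0 // (drop_nth a ltin).
Qed.

End SubwordAutomaton.

(** * From agreement on models to provability *)

(** Let x be the expansion of [s] with the exponent demanded by [expand_emb]. Reading x takes its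
    own automaton from state 0 to the last state; the value of [nfval s] lies above that of x, so it
    does the same, and so does that of [nfval t]. The latter is the value of an expansion of [t],
    which therefore contains x as a subword. *)
Lemma emb_of_models (S : pseudoset) (A : finType) (s t : seq (factor A)) :
  (forall n, models (infl_monoid n) S) ->
  (forall T, models T S -> forall f, omg_op (nfval s) T f = omg_op (nfval t) T f) ->
  all (@nonempty_factor A) s -> emb s t.
Proof.
move=> mS st s0; pose x := expand (size t).*2.+1 s.
pose T := infl_monoid (size x); apply: (@expand_emb A (#|T|)`!) => //.
rewrite -/x -(drop0 x) (@subseq_scan A x _ ord0) -omg_nfval -st //.
have /forallP /(_ ord0) := @wev_expand_le T (@infl_le (size x)) (@infl_le_refl _)
  (@infl_le1 _) (@infl_le_mul _) A (@scan A x) (size t).*2.+1 s.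
have := @subseq_scan A x x ord0; rewrite drop0 subseq_refl => /esym/eqP ->.
by rewrite eqn_leq => ->; rewrite -ltnS ltn_ord.
Qed.

Lemma h_strong_of_absorbing (S : pseudoset) : (exists p, S p) -> absorbing S ->
  (forall n, models (infl_monoid n) S) -> h_strong S.
Proof.
move=> inh abs mS A u v uv.
have [s us s0] := exists_nfval inh abs u; have [t vt t0] := exists_nfval inh abs v.
(* By soundness the normal forms inherit the validity of u = v in all models. *)
have st T : models T S -> forall f, omg_op (nfval s) T f = omg_op (nfval t) T f.
  move=> mT f; rewrite -(provable_sound us mT) -(provable_sound vt mT).
  exact: (uv T mT f).
apply: prov_trans us _; apply: prov_trans (provable_sym vt).
apply: emb_nfval => //; first exact: emb_of_models st s0.
by apply: emb_of_models mS _ t0 => T mT f; rewrite st.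
Qed.

Theorem theorem7p7 : h_strong SigmaSet /\ h_strong GammaSet.
Proof.
split.
- apply: h_strong_of_absorbing Sigma_absorbing _; first by eexists; left.
  move=> n; exact: (ordered_models_Sigma (@infl_le_refl n) (@infl_le_anti n)
    (@infl_le_trans n) (@infl_le1 n) (@infl_le_mul n)).
- apply: h_strong_of_absorbing Gamma_absorbing _; first by eexists; left.
  move=> n; exact: (ordered_models_Gamma (@infl_le_refl n) (@infl_le_anti n)
    (@infl_le_trans n) (@infl_le1 n) (@infl_le_mul n)).
Qed.
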